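(* Let $A\in\mathbb{M}(3,\mathbb{F}_q)$ be a non-scalar matrix such that the plane filling curve $C_A$ of degree $q+2$ is reducible over $\mathbb{F}_q$. Then $C_A$ contains a non-linear irreducible component if and only if the characteristic polynomial of $A$ is the minimal polynomial of $A$.
   Context: $\mathbb{F}_q$ is a finite field with $q$ elements, $\mathbb{M}(3,\mathbb{F}_q)$ is the set of $3\times3$ matrices over $\mathbb{F}_q$, and $x,y,z$ are homogeneous coordinates on $\mathbb{P}^2$. For $A\in\mathbb{M}(3,\mathbb{F}_q)$ let $$F_A(x,y,z)=(x,y,z)\,A\begin{pmatrix}y^qz-yz^q\\ z^qx-zx^q\\ x^qy-xy^q\end{pmatrix}.$$ It is known that $F_A=0$ as a polynomial if and only if $A$ is a scalar matrix. For non-scalar $A$, $C_A$ is the curve $F_A=0$ in $\mathbb{P}^2$; it has degree $q+2$ and passes through all $\mathbb{F}_q$-points of $\mathbb{P}^2$ (a ''plane filling curve''). *)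

(* Defs.v *)
From HB Require Import structures.
From mathcomp Require Import all_boot all_order all_algebra.
From mathcomp Require Export mpoly.

Set Implicit Arguments.
Unset Strict Implicit.
Unset Printing Implicit Defensive.

Import GRing.Theory.
Local Open Scope ring_scope.

Section Factorization.
Variable R : idomainType.
Implicit Types p : R.

Definition reducible p :=
  exists a b : R,
    [/\ p = a * b, a \isn't a GRing.unit & b \isn't a GRing.unit].

Definition irreducible p :=
  [/\ p != 0, p \isn't a GRing.unit &
      forall a b : R, p = a * b ->
        a \is a GRing.unit \/ b \is a GRing.unit].

Definition divides p1 p2 := exists c : R, p2 = p1 * c.

End Factorization.

Section FillingCurve.
Variable F : finFieldType.

Let q := #|F|.
Let x : {mpoly F[3]} := 'X_(inord 0).
Let y : {mpoly F[3]} := 'X_(inord 1).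
Let z : {mpoly F[3]} := 'X_(inord 2).

Definition coord_row : 'rV[{mpoly F[3]}]_3 := \row_j [:: x; y; z]`_j.

Definition frob_col : 'cV[{mpoly F[3]}]_3 :=
  \col_i [:: y ^+ q * z - y * z ^+ q;
             z ^+ q * x - z * x ^+ q;
             x ^+ q * y - x * y ^+ q]`_i.

Definition filling_form (A : 'M[F]_3) : {mpoly F[3]} :=
  (coord_row *m map_mx (@mpolyC 3 F) A *m frob_col) 0 0.

(* A plane curve over F is given by a form up to a nonzero scalar, and its
   components over F by the irreducible forms dividing it, with coefficients
   in F itself rather than in an algebraic closure. *)
Definition component_of_degree (d : nat) (G P : {mpoly F[3]}) :=
  [/\ G \is d.-homog, irreducible G & divides G P].

End FillingCurve.

(* Main.v *)
Require Import Defs.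
From Stdlib Require Import Classical.
From HB Require Import structures.
From mathcomp Require Import all_boot all_order all_algebra all_field.
From mathcomp Require Import abelian zify ring.

Set Implicit Arguments.
Unset Strict Implicit.
Unset Printing Implicit Defensive.

Import Order.TTheory GRing.Theory.
Local Open Scope ring_scope.

(** Let [X] be the row of coordinates and [X^q] its image under Frobenius. The
    entries of [frob_col] are the coordinates of the cross product of [X^q] and
    [X], so the filling form of [A] is the determinant with rows [X A], [X^q]
    and [X] ([filling_formE]). It depends on [A] only modulo scalar matrices,
    and a linear change of coordinates conjugates [A], up to a constant factor
    ([linear_subst_filling_form]).

    Putting a line in the position [X_0 = 0] and expanding in powers of [X_0]
    shows that a linear form [X v] divides the filling form only if [v] is an
    eigenvector of [A], and that its square divides it only if [A - a] has rank
    at most one for some [a] ([dvd_filling_form_eigenvector],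
    [dvd_sq_filling_form_rank]). For a non-scalar [A] of order three, such an
    [a] exists exactly when the minimal and the characteristic polynomials
    differ ([mxminpoly_shift_rank1], [mxminpoly_neq_char_rank1]).

    If they differ, then [A - a] is a dyad [u v], and the determinant becomes
    [X u] times the determinant with rows [v], [X^q] and [X]. In coordinates
    where [v] is the first basis vector, the latter is [y^q z - y z^q], up to a
    constant: the product of all lines over F_q through a point. The whole
    curve is thus a union of lines, and an irreducible component is one of
    them, because linear forms are prime ([filling_form_split],
    [irreducible_dvd_linear_forms]).

    If they are equal and all components are linear, then the filling form is a
    product of [q + 2 >= 4] linear forms ([linear_factorization]). No two of
    them are proportional, since no square divides the form; their
    eigenvectors belong to distinct eigenvalues, since two independent
    eigenvectors for the eigenvalue [a] would force [A - a] to have rank at most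
    one. But the characteristic polynomial has at most three roots
    ([dvd_filling_form_size]). *)

(** * Forms and their factors *)

Section HomogeneousFactors.
Variables (n : nat) (R : idomainType).
Implicit Types p q : {mpoly R[n]}.

(** Two terms of [p] and [q] whose exponents add up to the sum of the two
    smallest exponents must both have the smallest exponent. *)
Lemma mcoeffM_mlast p q : p != 0 -> q != 0 ->
  (p * q)@_(mlast p + mlast q) = p@_(mlast p) * q@_(mlast q).
Proof.
move=> nz_p nz_q; rewrite mpolyME (bigD1_seq (mlast p, mlast q)) /=; first last.
- by rewrite allpairs_uniq // => -[? ?] [].
- by rewrite allpairs_f // !mlast_supp.
rewrite mcoeffD mcoeffZ mcoeffX eqxx mulr1.
rewrite big_seq_cond raddf_sum /= big1 ?addr0 //.
case=> m1 m2 /andP[/allpairsP[[k1 k2] /= [+ + [-> ->]]] ne].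
move=> /mlast_lemc le1 /mlast_lemc le2; rewrite mcoeffZ mcoeffX.
case: eqP => [eqm | _]; last by rewrite mulr0.
case/negP: ne; rewrite xpair_eqE.
move: le1; rewrite le_eqVlt => /predU1P[E1|lt1].
  by move: eqm; rewrite E1 => /eqP; rewrite eqm_add2l !eqxx.
by have := ltmc_le_add lt1 le2; rewrite eqm ltxx.
Qed.

(** The largest and the smallest exponents of a product are the sums of those
    of its factors; if they have the same degree, then so do the largest and
    the smallest exponents of each factor. *)
Lemma dhomog_factor d p q : p * q != 0 -> p * q \is d.-homog ->
  exists e f, [/\ d = (e + f)%N, p \is e.-homog & q \is f.-homog].
Proof.
move=> nz_pq /dhomogP hom.
have /norP[nz_p nz_q] : ~~ ((p == 0) || (q == 0)) by rewrite -mulf_eq0.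
have nz_lead (r : {mpoly R[n]}) : r != 0 -> r@_(mlead r) != 0.
  by rewrite mleadc_eq0.
have nz_last (r : {mpoly R[n]}) : r != 0 -> r@_(mlast r) != 0.
  by move=> ?; rewrite -mcoeff_msupp mlast_supp.
have deg_lead : (mdeg (mlead p) + mdeg (mlead q))%N = d.
  rewrite -mdegD; apply: hom.
  by rewrite mcoeff_msupp mleadcM mulf_neq0 ?nz_lead.
have deg_last : (mdeg (mlast p) + mdeg (mlast q))%N = d.
  rewrite -mdegD; apply: hom.
  by rewrite mcoeff_msupp mcoeffM_mlast // mulf_neq0 ?nz_last.
have bounds (r : {mpoly R[n]}) m : m \in msupp r ->
    (mdeg (mlast r) <= mdeg m <= mdeg (mlead r))%N.
  by move=> rm; rewrite !lemc_mdeg ?mlast_lemc ?msupp_le_mlead.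
have /andP[_ lep] := bounds p _ (mlast_supp nz_p).
have /andP[_ leq] := bounds q _ (mlast_supp nz_q).
have [eqp eqq] : mdeg (mlast p) = mdeg (mlead p) /\
                 mdeg (mlast q) = mdeg (mlead q).
  by split; lia.
exists (mdeg (mlead p)), (mdeg (mlead q)); split=> //.
  by apply/dhomogP=> m /bounds; rewrite eqp -eqn_leq => /eqP.
by apply/dhomogP=> m /bounds; rewrite eqq -eqn_leq => /eqP.
Qed.

Lemma dhomog0_polyC p : p \is 0.-homog -> p = (p@_0%MM)%:MP.
Proof.
move=> hom; apply/mpolyP=> m; rewrite mcoeffC.
have [->|nz_m] := eqVneq m 0%MM; first by rewrite mulr1.
by rewrite mulr0 (dhomog_nemf_coeff hom) // mdeg_eq0.
Qed.

End HomogeneousFactors.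

Section LinearForms.
Variables (F : fieldType) (n : nat).
Implicit Types (p q G P : {mpoly F[n]}) (v w : 'cV[F]_n).

Lemma mpoly_unitP p : reflect (exists2 c, c != 0 & p = c%:MP)
  (p \is a GRing.unit).
Proof.
apply: (iffP andP) => [[/eqP def_p c_unit]|[c nz_c ->]].
  by exists (p@_0%MM) => //; rewrite -unitfE.
by rewrite mcoeffC eqxx mulr1 unitfE.
Qed.

Lemma dhomog_nonunit d p : p \is d.-homog -> (0 < d)%N ->
  p \isn't a GRing.unit.
Proof.
move=> hom d0; apply/mpoly_unitP=> -[c nz_c p_c].
have nz_p : p != 0 by rewrite p_c mpolyC_eq0.
have hom0 : p \is 0.-homog.
  by rewrite p_c -[_%:MP]mulr1 mul_mpolyC rpredZ ?dhomog1.
by rewrite (dhomog_uniq nz_p hom hom0) in d0.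
Qed.

Definition linear_form v : {mpoly F[n]} := \sum_i v i 0 *: 'X_i.

Lemma linear_form_homog v : linear_form v \is 1.-homog.
Proof.
apply: rpred_sum => i _; apply: rpredZ; rewrite dhomogX.
exact/eqP/mdeg1.
Qed.

Lemma mcoeff_linear_form v i : (linear_form v)@_U_(i) = v i 0.
Proof.
rewrite raddf_sum (bigD1 i) //= mcoeffZ mcoeffXU eqxx mulr1 big1 ?addr0 //.
by move=> j ne_ji; rewrite mcoeffZ mcoeffXU (negbTE ne_ji) mulr0.
Qed.

Lemma linear_form_eq0 v : (linear_form v == 0) = (v == 0).
Proof.
apply/eqP/eqP=> [v0|->].
  by apply/colP=> i; rewrite -mcoeff_linear_form v0 mcoeff0 mxE.
by rewrite /linear_form big1 // => i _; rewrite mxE scale0r.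
Qed.

Lemma dhomog1_linear_form p : p \is 1.-homog ->
  p = linear_form (\col_i p@_U_(i)).
Proof.
move=> hom; apply/mpolyP=> m.
have [/eqP/mdeg1P[i /eqP->]|m1] := eqVneq (mdeg m) 1%N.
  by rewrite mcoeff_linear_form mxE.
by rewrite !(dhomog_nemf_coeff _ m1) ?linear_form_homog.
Qed.

(** If the [i]-th coefficient of [v] is nonzero, substituting for [X_i] its
    value on the hyperplane [linear_form v = 0] changes a polynomial by a
    multiple of [linear_form v]. *)
Definition hyperplane_subst v i : n.-tuple {mpoly F[n]} :=
  [tuple 'X_j - (i == j)%:R *: ((v i 0)^-1 *: linear_form v) | j < n].

Lemma hyperplane_substB v i p :
  divides (linear_form v) (p - (p \mPo hyperplane_subst v i)).
Proof.
set l := linear_form v; set s := hyperplane_subst v i.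
pose eqm (a b : {mpoly F[n]}) := divides l (a - b).
have eqmM a b c d : eqm a b -> eqm c d -> eqm (a * c) (b * d).
  move=> [x abx] [y cdy]; exists (x * c + b * y).
  have -> : a * c - b * d = (a - b) * c + b * (c - d) by ring.
  by rewrite abx cdy; ring.
have eqmX a b k : eqm a b -> eqm (a ^+ k) (b ^+ k).
  move=> ab; elim: k => [|k IHk]; first by exists 0; rewrite subrr mulr0.
  by rewrite !exprS; apply: eqmM.
rewrite -/(eqm _ _) -{1}(comp_mpoly_id p) !comp_mpolyEX.
apply: (big_ind2 eqm) => [|a b c d [x abx] [y cdy]|m _].
- by exists 0; rewrite subrr mulr0.
- exists (x + y).
  have -> : a + c - (b + d) = (a - b) + (c - d) by ring.
  by rewrite abx cdy; ring.
rewrite -!mul_mpolyC; apply: (eqmM _ _ _ _).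
  by exists 0; rewrite subrr mulr0.
rewrite !comp_mpolyX; apply: (big_ind2 eqm) => [||j _].
- by exists 0; rewrite subrr mulr0.
- by move=> a b c d; apply: eqmM.
apply: eqmX; rewrite !tnth_mktuple; exists ((i == j)%:R *: ((v i 0)^-1)%:MP).
by rewrite opprB addrC subrK -!mul_mpolyC -/l mulrA mulrC.
Qed.

Lemma linear_form_subst v i : v i 0 != 0 ->
  linear_form v \mPo hyperplane_subst v i = 0.
Proof.
move=> nz_vi; have sX j : 'X_j \mPo hyperplane_subst v i =
    'X_j - (i == j)%:R *: ((v i 0)^-1 *: linear_form v).
  by rewrite comp_mpolyXU -tnth_nth tnth_mktuple.
rewrite {1}/linear_form raddf_sum /=.
under eq_bigr do rewrite linearZ /= sX scalerBr.
rewrite big_split /= -/(linear_form v) (bigD1 i) //= eqxx scale1r.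
rewrite scalerA divff // scale1r big1 ?addr0 ?subrr // => j ne_ji.
by rewrite eq_sym (negbTE ne_ji) scale0r scaler0 oppr0.
Qed.

Lemma linear_form_dvd_subst v i p : v i 0 != 0 ->
  divides (linear_form v) p <-> p \mPo hyperplane_subst v i = 0.
Proof.
move=> nz_vi; split=> [[c ->]|p0].
  by rewrite rmorphM /= linear_form_subst // mul0r.
by have := hyperplane_substB v i p; rewrite p0 subr0.
Qed.

(** The substitution above is a ring morphism into an integral domain whose
    kernel is generated by [linear_form v]. *)
Lemma linear_form_prime v p q : v != 0 -> divides (linear_form v) (p * q) ->
  divides (linear_form v) p \/ divides (linear_form v) q.
Proof.
move=> nz_v; have [i nz_vi] : exists i, v i 0 != 0.
  apply/existsP; apply: contraR nz_v; rewrite negb_exists => /forallP v0.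
  by apply/eqP/colP=> i; rewrite mxE; apply/eqP; have := v0 i; rewrite negbK.
rewrite !(linear_form_dvd_subst _ nz_vi) rmorphM /= => /eqP.
by rewrite mulf_eq0 => /orP[]/eqP; [left | right].
Qed.

(** A linear form that divides [G p] either divides [G], which is then
    proportional to it, or can be cancelled from [p]. *)
Lemma irreducible_dvd_linear_forms d G c (vs : seq 'cV[F]_n) :
  G \is d.-homog -> irreducible G -> c != 0 -> all (fun v => v != 0) vs ->
  divides G (c *: \prod_(v <- vs) linear_form v) -> (d <= 1)%N.
Proof.
move=> homG [nzG nuG irrG] nz_c nz_vs [p].
elim: vs nz_vs p => [_ p|v vs IHvs /= /andP[nz_v nz_vs] p].
  rewrite big_nil => cGp; case/negP: nuG.
  have : G * p \is a GRing.unit.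
    by rewrite -cGp -mul_mpolyC mulr1; apply/mpoly_unitP; exists c.
  by rewrite unitrM => /andP[].
rewrite big_cons scalerAr => def_Gp.
have nz_l : linear_form v != 0 by rewrite linear_form_eq0.
have [] : divides (linear_form v) G \/ divides (linear_form v) p.
  by apply: linear_form_prime => //; rewrite -def_Gp; eexists.
- move=> [e def_G]; have [|/mpoly_unitP[k _ def_e]] := irrG _ _ def_G.
    by rewrite (negbTE (dhomog_nonunit (linear_form_homog v) _)).
  have homG1 : G \is 1.-homog.
    by rewrite def_G def_e mulrC mul_mpolyC rpredZ ?linear_form_homog.
  by rewrite (dhomog_uniq nzG homG homG1).
- move=> [e def_p]; apply: (IHvs nz_vs e); apply: (mulfI nz_l).
  by rewrite def_Gp def_p; ring.
Qed.

(** As the factors of a form are forms, a reducible form splits into forms of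
    smaller positive degree; an irreducible one has degree one by hypothesis. *)
Lemma linear_factorization d P : P != 0 -> P \is d.-homog ->
  (forall e G, G \is e.-homog -> irreducible G -> divides G P -> (e <= 1)%N) ->
  exists c (vs : seq 'cV[F]_n),
    [/\ size vs = d, all (fun v => v != 0) vs &
        P = c *: \prod_(v <- vs) linear_form v].
Proof.
elim/ltn_ind: d P => d IHd P nzP homP irr_lin.
have [d0|d_gt0] := posnP d.
  rewrite d0 in homP; exists (P@_0%MM), [::]; split=> //.
  by rewrite big_nil -mul_mpolyC mulr1 -dhomog0_polyC.
have nuP := dhomog_nonunit homP d_gt0.
have [irrP|redP] := classic (irreducible P).
  have d1 : d = 1%N.
    apply/eqP; rewrite eqn_leq d_gt0 andbT.
    by apply: irr_lin irrP _ => //; exists 1; rewrite mulr1.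
  rewrite d1 in homP *; have def_P := dhomog1_linear_form homP.
  exists 1, [:: \col_i P@_U_(i)]; split=> //=.
    by rewrite andbT -linear_form_eq0 -def_P.
  by rewrite scale1r big_seq1.
have [a [b [def_P nua nub]]] : exists a b,
    [/\ P = a * b, a \isn't a GRing.unit & b \isn't a GRing.unit].
  apply: NNPP => no_ab; apply: redP; split=> // a b def_P.
  apply: NNPP => /not_or_and[/negP nua /negP nub].
  by apply: no_ab; exists a, b.
have nz_ab : a * b != 0 by rewrite -def_P.
have [e [f [def_d homa homb]]] : exists e f,
    [/\ d = (e + f)%N, a \is e.-homog & b \is f.-homog].
  by apply: dhomog_factor; rewrite -?def_P.
have /norP[nza nzb] : ~~ ((a == 0) || (b == 0)) by rewrite -mulf_eq0.
have pos k (p : {mpoly F[n]}) : p != 0 -> p \is k.-homog ->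
    p \isn't a GRing.unit -> (0 < k)%N.
  move=> nzp homp; apply: contraNltn; rewrite leqn0 => /eqP k0.
  rewrite k0 in homp; have def_p := dhomog0_polyC homp.
  apply/mpoly_unitP; exists p@_0%MM => //.
  by rewrite -(@mpolyC_eq0 n) -def_p.
have e_gt0 := pos _ _ nza homa nua; have f_gt0 := pos _ _ nzb homb nub.
have [||c [vs [sz_vs nz_vs def_a]]] := IHd e _ a nza homa.
- by lia.
- move=> k G homG irrG [p ap]; apply: irr_lin homG irrG _.
  by exists (p * b); rewrite def_P ap mulrA.
have [||c' [ws [sz_ws nz_ws def_b]]] := IHd f _ b nzb homb.
- by lia.
- move=> k G homG irrG [p bp]; apply: irr_lin homG irrG _.
  by exists (a * p); rewrite def_P bp mulrCA.
exists (c * c'), (vs ++ ws); split.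
- by rewrite size_cat sz_vs sz_ws.
- by rewrite all_cat nz_vs.
- by rewrite def_P def_a def_b big_cat /= -scalerAl -scalerAr scalerA.
Qed.

End LinearForms.

(** * Ranks, eigenvectors and the minimal polynomial *)

Section MatrixLemmas.
Variable F : fieldType.

Lemma rank1_factor m n (N : 'M[F]_(m, n)) : \rank N = 1%N ->
  exists (u : 'cV[F]_m) (v : 'rV[F]_n), [/\ u != 0, v != 0 & N = u *m v].
Proof.
move=> rN; have nzN : N != 0 by rewrite -mxrank_eq0 rN.
move: (mulmx_base N); move: (col_base N) (row_base N); rewrite rN => u v def_N.
exists u, v; split=> //; apply: contra nzN => /eqP z; rewrite -def_N z.
  by rewrite mul0mx.
by rewrite mulmx0.
Qed.

Lemma unitmx_row0 n (v : 'rV[F]_n.+1) : v != 0 ->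
  exists2 B, B \in unitmx & v = delta_mx 0 0 *m B.
Proof.
move=> nz_v; pose f := (delta_mx 0 0)^T *m v : 'M[F]_n.+1.
have ef : delta_mx 0 0 *m f = v.
  rewrite /f trmx_delta mulmxA mul_delta_mx -[RHS]mul1mx; congr (_ *m v).
  by apply/matrixP=> i j; rewrite !ord1 !mxE.
have [|B uB eB] := @complete_unitmx _ _ _ (delta_mx 0 0 : 'rV_n.+1) f.
  by rewrite ef mxrank_delta rank_rV nz_v.
by exists B => //; rewrite -eB ef.
Qed.

Lemma unitmx_col0 n (v : 'cV[F]_n.+1) : v != 0 ->
  exists2 B, B \in unitmx & B *m v = delta_mx 0 0.
Proof.
rewrite -trmx_eq0 => /unitmx_row0[B uB def_v].
have uBt : B^T \in unitmx by rewrite unitmx_tr.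
exists (invmx B^T); first by rewrite unitmx_inv.
by rewrite -[v]trmxK def_v trmx_mul mulKmx // trmx_delta.
Qed.

(** Two independent eigenvectors for [a] span a plane in the kernel of
    [A - a]. *)
Lemma rank_shift_eigenvectors n (A : 'M[F]_n) a (v w : 'cV[F]_n) :
  v != 0 -> (forall c, w != c *: v) -> A *m v = a *: v -> A *m w = a *: w ->
  (\rank (A - a%:M)%R + 2 <= n)%N.
Proof.
move=> nz_v w_v Av Aw; have N0 : (A - a%:M) *m row_mx v w = 0.
  by rewrite mul_mx_row !mulmxBl !mul_scalar_mx Av Aw !subrr row_mx0.
apply: leq_trans (mulmx0_rank_max N0); rewrite leq_add2l.
rewrite -mxrank_tr tr_row_mx -addsmxE.
have lt_v : (v^T < v^T + w^T)%MS.
  rewrite ltmxE addsmxSl /= addsmx_sub submx_refl /=.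
  by apply/sub_rVP=> -[c /(congr1 trmx)]; rewrite linearZ /= !trmxK => /eqP;
     rewrite (negbTE (w_v c)).
by have := rank_ltmx lt_v; rewrite rank_rV trmx_eq0 nz_v.
Qed.

(** A matrix [A - a] of rank at most one is a dyad [u v], whose square is
    [v u] times itself: [A] is a root of a quadratic polynomial. *)
Lemma mxminpoly_shift_rank1 n (A : 'M[F]_n.+3) a : (\rank (A - a%:M)%R <= 1)%N ->
  char_poly A != mxminpoly A.
Proof.
move=> rk1; apply/eqP=> char_min.
have [t N2] : exists t, (A - a%:M) *m (A - a%:M) = t *: (A - a%:M).
  move: rk1; rewrite leq_eqVlt ltnS leqn0 => /orP[/eqP/rank1_factor|].
    move=> [u [v [_ _ ->]]]; exists ((v *m u) 0 0).
    rewrite mulmxA -(mulmxA u) {1}[v *m u]mx11_scalar mul_mx_scalar.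
    by rewrite scalemxAl.
  by rewrite mxrank_eq0 => /eqP->; exists 0; rewrite mulmx0 scaler0.
pose p := ('X - a%:P) * ('X - (a + t)%:P).
have pA0 : horner_mx A p = 0.
  rewrite rmorphM !rmorphB /= horner_mx_X !horner_mx_C raddfD /= opprD addrA.
  by rewrite mulrBr -!mulmxE N2 mul_mx_scalar subrr.
have nz_p : p != 0 by rewrite mulf_neq0 ?polyXsubC_eq0.
have := dvdp_leq nz_p (mxminpoly_min pA0).
by rewrite -char_min size_char_poly size_mul ?polyXsubC_eq0 ?size_XsubC.
Qed.

(** The minimal polynomial is quadratic, and the cofactor of the characteristic
    polynomial is some [T - a], where [a] must also be a root of the minimal
    polynomial. The latter thus splits as [(T - b) (T - a)], and as
    [(A - b) (A - a) = 0], the ranks of these two matrices add up to at most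
    three. *)
Lemma mxminpoly_neq_char_rank1 (A : 'M[F]_3) :
  ~~ is_scalar_mx A -> char_poly A != mxminpoly A ->
  exists a, \rank (A - a%:M) = 1%N.
Proof.
move=> nscA neq; have mon := mxminpoly_monic A.
have [r def_char] : exists r : {poly F}, char_poly A = r * mxminpoly A.
  exact/dvdpP/mxminpoly_dvd_char.
have nz_m : mxminpoly A != 0 by rewrite monic_neq0.
have nz_char : char_poly A != 0 by rewrite monic_neq0 ?char_poly_monic.
have nz_r : r != 0 by apply: contraNneq nz_char => r0; rewrite def_char r0 mul0r.
have sz_m : (2 < size (mxminpoly A))%N.
  by rewrite size_mxminpoly ltnS ltnNge mxminpoly_linear_is_scalar.
have := size_char_poly A; rewrite def_char size_mul // => sz.
have mon_r : r \is monic.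
  by rewrite -(monicMr _ mon) -def_char char_poly_monic.
have sz_r : size r = 2%N.
  have : (0 < size r)%N by rewrite size_poly_gt0.
  have : size r != 1%N.
    apply: contra neq => /eqP sz1; rewrite def_char.
    have /size_poly1P[c _ rc] : size r == 1%N by exact/eqP.
    by move: mon_r; rewrite rc monicE lead_coefC => /eqP->; rewrite mul1r.
  move: sz sz_m; move: (size (mxminpoly A)) (size r) => x y; lia.
have sz_m3 : size (mxminpoly A) = 3%N by move: sz; rewrite sz_r => -[].
have monic2 (p : {poly F}) : p \is monic -> size p = 2%N ->
    exists a, p = 'X - a%:P.
  move=> mon_p sz_p; exists (- p`_0); rewrite polyCN opprK.
  apply/polyP=> -[|[|i]]; rewrite coefD coefX coefC /= ?add0r ?addr0 //.
    by move/monicP: mon_p; rewrite lead_coefE sz_p.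
  by rewrite nth_default ?sz_p.
have [a def_r] := monic2 r mon_r sz_r.
have : root (mxminpoly A) a.
  by rewrite root_mxminpoly def_char rootM def_r root_XsubC eqxx.
rewrite -dvdp_XsubCl => /dvdpP[s def_m].
have nz_s : s != 0 by apply: contraNneq nz_m => s0; rewrite def_m s0 mul0r.
have [b def_s] : exists b, s = 'X - b%:P.
  apply: monic2; first by rewrite -(monicMr _ (monicXsubC a)) -def_m.
  move: sz_m3; rewrite def_m size_mul ?polyXsubC_eq0 // size_XsubC addn2.
  by case.
have : (A - b%:M) *m (A - a%:M) = 0.
  have := mx_root_minpoly A; rewrite def_m def_s rmorphM !rmorphB /=.
  by rewrite horner_mx_X !horner_mx_C mulmxE.
move=> /mulmx0_rank_max rk3.
have rk_gt0 c : (0 < \rank (A - c%:M)%R)%N.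
  rewrite lt0n mxrank_eq0 subr_eq0; apply: contra nscA => /eqP->.
  exact: scalar_mx_is_scalar.
move: rk3 (rk_gt0 a) (rk_gt0 b).
have [rk_a rk3 gt0_a _|rk_a rk3 _ gt0_b] := leqP (\rank (A - a%:M)%R) 1.
  by exists a; apply/eqP; rewrite eqn_leq rk_a.
exists b; apply/eqP; rewrite eqn_leq gt0_b andbT -(leq_add2r 2).
by apply: leq_trans rk3; rewrite leq_add2l.
Qed.

Lemma eigenvector_root_char n (A : 'M[F]_n) a (v : 'cV[F]_n) :
  v != 0 -> A *m v = a *: v -> root (char_poly A) a.
Proof.
move=> nz_v Av; rewrite -eigenvalue_root_char /eigenvalue /eigenspace kermx_eq0.
apply: contra nz_v; rewrite row_free_unit => uN.
by rewrite -(mulKmx uN v) mulmxBl Av mul_scalar_mx subrr mulmx0.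
Qed.

End MatrixLemmas.

(** * The filling form as a determinant *)

Local Notation i0 := (ord0 : 'I_3).
Local Notation i1 := (lift ord0 ord0 : 'I_3).
Local Notation i2 := (lift ord0 (lift ord0 ord0) : 'I_3).

Section TripleProduct.
Variable R : comNzRingType.
Implicit Types (a b c : 'rV[R]_3).

Definition triple a b c : R :=
  \det (\matrix_(i < 3, j < 3) (nth 0 [:: a; b; c] i) 0 j).

Lemma tripleE a b c : triple a b c =
  a 0 i0 * (b 0 i1 * c 0 i2 - b 0 i2 * c 0 i1) +
  a 0 i1 * (b 0 i2 * c 0 i0 - b 0 i0 * c 0 i2) +
  a 0 i2 * (b 0 i0 * c 0 i1 - b 0 i1 * c 0 i0).
Proof.
(* Indexing by [nat] makes the nested [lift]s of the cofactors compute. *)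
have [f fE] : exists f : 'rV[R]_3 -> nat -> R,
    forall (u : 'rV_3) (j : 'I_3), u 0 j = f u j.
  by exists (fun u k => u 0 (inord k)) => u j; rewrite inord_val.
rewrite /triple (expand_det_row _ ord0) !big_ord_recl big_ord0 /cofactor.
rewrite !(expand_det_row _ ord0) !big_ord_recl !big_ord0 /cofactor !det_mx11.
rewrite !mxE !fE /= /bump /= ?(add0n, addn0, add1n) !(expr0, expr1, sqrrN); ring.
Qed.

Lemma triple_mulmx a b c (B : 'M[R]_3) :
  triple (a *m B) (b *m B) (c *m B) = triple a b c * \det B.
Proof.
rewrite /triple -det_mulmx; congr (\det _); apply/matrixP=> i j.
rewrite !mxE; case: i => -[|[|[|//]]] i3 /=; rewrite mxE;
  by apply: eq_bigr => k _; rewrite mxE.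
Qed.

Lemma triple_combl x y a b c d :
  triple (x *: a + y *: d) b c = x * triple a b c + y * triple d b c.
Proof. by rewrite !tripleE !mxE; ring. Qed.

Lemma triple_eq_last b c : triple c b c = 0.
Proof. by rewrite tripleE; ring. Qed.

End TripleProduct.

Lemma rmorph_triple (R S : comNzRingType) (f : {rmorphism R -> S}) a b c :
  f (triple a b c) = triple (map_mx f a) (map_mx f b) (map_mx f c).
Proof. by rewrite !tripleE !mxE; rewrite !(rmorphD, rmorphN, rmorphM). Qed.

Section Frobenius.
Variables (F : finFieldType) (n : nat).
Local Notation q := #|F|.
Implicit Types p r : {mpoly F[n]}.

Definition frob_mx m (u : 'rV[{mpoly F[n]}]_m) := map_mx (fun p => p ^+ q) u.

(** The number [q] of elements of the field is a power of its characteristic. *)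
Lemma mpoly_cardXD p r : (p + r) ^+ q = p ^+ q + r ^+ q.
Proof.
have [l pr_l pcharFl] := finPcharP F.
apply: exprDn_pchar.
have pcharl : l \in [pchar {mpoly F[n]}] by exact: (rmorph_pchar (@mpolyC n F)).
rewrite (eq_pnat _ (pcharf_eq pcharl)) -cardsT.
exact/abelem_pgroup/fin_ring_pchar_abelem.
Qed.

Lemma frob_mxM m k (u : 'rV[{mpoly F[n]}]_m) (B : 'M[F]_(m, k)) :
  frob_mx (u *m map_mx (@mpolyC n F) B) = frob_mx u *m map_mx (@mpolyC n F) B.
Proof.
have q_neq0 : (q == 0)%N = false.
  by apply/negbTE; rewrite -lt0n; apply/card_gt0P; exists 0.
apply/rowP=> j; rewrite !mxE (big_morph _ mpoly_cardXD (expr0n _ _)) q_neq0.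
by apply: eq_bigr => i _; rewrite !mxE exprMn -rmorphXn /= expf_card.
Qed.

End Frobenius.

Section Substitution.
Variable F : finFieldType.
Local Notation q := #|F|.
Local Notation X := (coord_row F).
Local Notation "B ^C" := (map_mx (@mpolyC 3 F) B) : ring_scope.
Implicit Types (A B : 'M[F]_3) (v w : 'cV[F]_3).

Lemma coord_rowE j : X 0 j = 'X_j.
Proof.
by rewrite mxE; case: j => -[|[|[|//]]] lt_j3 /=; congr 'X_(_); apply: val_inj;
   rewrite /= inordK.
Qed.

Lemma filling_formE A : filling_form A = triple (X *m A^C) (frob_mx X) X.
Proof.
rewrite tripleE /filling_form; move: (X *m A^C) => w.
by rewrite mxE !big_ord_recl big_ord0 !mxE /=; ring.
Qed.

Lemma filling_form_homog A : filling_form A \is (q + 2).-homog.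
Proof.
have homX j : X 0 j \is 1.-homog.
  by rewrite coord_rowE dhomogX; apply/eqP/mdeg1.
have homXA j : (X *m A^C) 0 j \is 1.-homog.
  rewrite mxE rpred_sum // => k _; rewrite [map_mx _ _ _ _]mxE mulrC mul_mpolyC.
  exact/rpredZ/homX.
have homXq j : frob_mx X 0 j \is q.-homog.
  by rewrite mxE; have := dhomogMn q (homX j); rewrite mul1n.
have -> : (q + 2 = 1 + (q + 1))%N by lia.
have hom j k l : (X *m A^C) 0 j * (frob_mx X 0 k * X 0 l - frob_mx X 0 l * X 0 k)
    \is (1 + (q + 1)).-homog.
  by apply: dhomogM => //; apply: rpredB; apply: dhomogM.
by rewrite filling_formE tripleE !rpredD.
Qed.

Lemma linear_formE v : linear_form v = (X *m v^C) 0 0.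
Proof.
rewrite mxE; apply: eq_bigr => i _.
by rewrite coord_rowE [map_mx _ _ _ _]mxE mulrC mul_mpolyC.
Qed.

Definition linear_subst B : 3.-tuple {mpoly F[3]} :=
  [tuple (X *m B^C) 0 i | i < 3].

Lemma linear_subst_coord B :
  map_mx (comp_mpoly (linear_subst B)) X = X *m B^C.
Proof.
apply/rowP=> j; rewrite mxE coord_rowE comp_mpolyXU -tnth_nth.
by rewrite tnth_mktuple.
Qed.

Lemma linear_subst_scalar_mx B m n (M : 'M[F]_(m, n)) :
  map_mx (comp_mpoly (linear_subst B)) M^C = M^C.
Proof. by apply/matrixP=> i j; rewrite !mxE /= comp_mpolyC. Qed.

Lemma linear_subst_linear_form B v :
  linear_form v \mPo linear_subst B = linear_form (B *m v).
Proof.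
rewrite !linear_formE map_mxM mulmxA -(linear_subst_coord B).
rewrite -[in RHS](linear_subst_scalar_mx B v) -map_mxM.
by rewrite [RHS]mxE.
Qed.

(** Both [A] and the Frobenius map commute with the substitution [X B], so its
    effect on the determinant is a multiplication by [B] on the right. *)
Lemma linear_subst_filling_form A A' B : B *m A = A' *m B ->
  filling_form A \mPo linear_subst B = \det B *: filling_form A'.
Proof.
move=> BA; rewrite !filling_formE rmorph_triple map_mxM.
have -> : map_mx (comp_mpoly (linear_subst B)) (frob_mx X) =
    frob_mx X *m B^C.
  rewrite -frob_mxM -linear_subst_coord; apply/rowP=> j.
  by rewrite !mxE rmorphXn.
rewrite linear_subst_scalar_mx linear_subst_coord -mulmxA -map_mxM BA map_mxM.
by rewrite mulmxA triple_mulmx det_map_mx mulrC mul_mpolyC.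
Qed.

End Substitution.

(** * Linear components *)

Section LinearComponents.
Variable F : finFieldType.
Local Notation q := #|F|.
Local Notation X := (coord_row F).
Local Notation "B ^C" := (map_mx (@mpolyC 3 F) B) : ring_scope.
Implicit Types (A B : 'M[F]_3) (v w : 'cV[F]_3).

(** The affine chart where the last coordinate is [1], with the first coordinate
    as the outer variable, so that divisibility by powers of it can be read off
    the lowest coefficients. *)
Definition affine_point (i : 'I_3) : {poly {poly F}} := [:: 'X; 'X%:P; 1]`_i.

Definition dehomogenize : {rmorphism {mpoly F[3]} -> {poly {poly F}}} :=
  mmap (polyC \o polyC : {rmorphism F -> {poly {poly F}}}) affine_point.

Lemma dehomogenizeX i : dehomogenize 'X_i = [:: 'X; 'X%:P; 1]`_i.
Proof. by rewrite /dehomogenize /= mmapX mmap1U. Qed.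

Lemma dehomogenizeC c : dehomogenize c%:MP = c%:P%:P.
Proof. exact: mmapC. Qed.

Lemma dehomogenizeM (p r : {mpoly F[3]}) :
  dehomogenize (p * r) = dehomogenize p * dehomogenize r.
Proof. exact: rmorphM. Qed.

(** The remainder [r] exists because [q >= 2]: the terms with the [q]-th power
    of the first coordinate do not contribute to the two lowest coefficients. *)
Lemma dehomogenize_filling_form A k : q = k.+2 ->
  let b j : {poly F} := (A i1 j)%:P * 'X + (A i2 j)%:P in
  let c0 := b i0 * ('X^q - 'X) in
  let c1 := (A i0 i0)%:P * ('X^q - 'X) + b i1 - b i2 * 'X^q in
  exists r, dehomogenize (filling_form A) = c0%:P + c1%:P * 'X + r * 'X^2.
Proof.
move=> qk b c0 c1.
pose a j : {poly {poly F}} := (A i0 j)%:P%:P * 'X + (b j)%:P.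
exists ((A i0 i1)%:P%:P - (A i0 i2)%:P%:P * ('X^q)%:P
  + 'X^k * (a i2 * 'X%:P - a i1)).
have aE j : map_mx dehomogenize (X *m A^C) 0 j = a j.
  rewrite mxE mxE rmorph_sum !big_ord_recl big_ord0 /= !coord_rowE !mxE.
  rewrite !rmorphM /= !dehomogenizeX !dehomogenizeC /a /b /= rmorphD rmorphM.
  by ring.
have XE j : map_mx dehomogenize X 0 j = [:: 'X; 'X%:P; 1]`_j.
  by rewrite mxE coord_rowE dehomogenizeX.
have XqE j : map_mx dehomogenize (frob_mx X) 0 j = [:: 'X; 'X%:P; 1]`_j ^+ q.
  by rewrite !mxE rmorphXn /= -XE mxE mxE.
rewrite filling_formE rmorph_triple tripleE !aE !XE !XqE /= expr1n.
rewrite /a /c0 /c1 /b !(rmorphD, rmorphN, rmorphM, rmorphXn) /= qk !exprS; ring.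
Qed.

Variant ord3_spec (i : 'I_3) : Prop :=
  | Ord3_0 of i = i0 | Ord3_1 of i = i1 | Ord3_2 of i = i2.

Lemma ord3P i : ord3_spec i.
Proof.
by case: i => -[|[|[|//]]] lt_i3;
   [constructor 1 | constructor 2 | constructor 3]; apply: val_inj.
Qed.

Lemma card_finField_SS : exists k, q = k.+2.
Proof.
have : (1 < q)%N by apply/card_gt1P; exists 0, 1; rewrite eq_sym oner_eq0.
by case: #|F| => [|[|k]] // _; exists k.
Qed.

Lemma coef01 (R : nzRingType) (c0 c1 : R) r
  (p := c0%:P + c1%:P * 'X + r * 'X^2) : p`_0 = c0 /\ p`_1 = c1.
Proof. by rewrite /p !coefD !coefMX !coefMXn !coefC /= !addr0 add0r. Qed.

(** On the line [X_0 = 0], the filling form restricts to the product of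
    [A_10 y + A_20 z] and the nonzero form [y^q z - y z^q]. *)
Lemma dvd_X0_filling_form A : divides 'X_i0 (filling_form A) ->
  A i1 i0 = 0 /\ A i2 i0 = 0.
Proof.
have [k qk] := card_finField_SS; move=> [p /(congr1 dehomogenize)].
have [r ->] := dehomogenize_filling_form A qk.
rewrite dehomogenizeM dehomogenizeX /=.
move=> /(congr1 (fun s : {poly {poly F}} => s`_0)).
rewrite (coef01 _ _ _).1 coefXM => /eqP.
have nz_frob : 'X^q - 'X != 0 :> {poly F}.
  apply/eqP=> /(congr1 (fun s : {poly F} => s`_1)) /eqP.
  by rewrite coefB coefXn coefX qk coef0 /= sub0r oppr_eq0 oner_eq0.
rewrite mulf_eq0 (negbTE nz_frob) orbF => /eqP b0.
split.
  move/(congr1 (fun s : {poly F} => s`_1)): b0.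
  by rewrite coefD coefMX !coefC /= addr0.
move/(congr1 (fun s : {poly F} => s`_0)): b0.
by rewrite coefD coefMX !coefC /= add0r.
Qed.

(** In the chart [z = 1], the coefficient of [X_0] is a combination of the
    monomials [1], [y], [y^q] and [y^(q+1)], which are distinct. Its vanishing,
    together with that of the constant coefficient, annihilates the last two
    rows of [A - A_00]. *)
Lemma dvd_X0sq_filling_form A : divides ('X_i0 ^+ 2) (filling_form A) ->
  (\rank (A - (A i0 i0)%:M)%R <= 1)%N.
Proof.
move=> dvd_X2; have [A10 A20] : A i1 i0 = 0 /\ A i2 i0 = 0.
  case: dvd_X2 => p def_p; apply: dvd_X0_filling_form.
  by exists ('X_i0 * p); rewrite mulrA -expr2.
have [k qk] := card_finField_SS; move: dvd_X2 => [p /(congr1 dehomogenize)].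
have [r ->] := dehomogenize_filling_form A qk.
rewrite expr2 !dehomogenizeM dehomogenizeX /= -expr2.
move=> /(congr1 (fun s : {poly {poly F}} => s`_1)).
rewrite (coef01 _ _ _).2 coefXnM /= => c1.
have coef_c1 j : _ := congr1 (fun s : {poly F} => s`_j) c1.
move: (coef_c1 0) (coef_c1 1%N) (coef_c1 k.+2) (coef_c1 k.+3).
rewrite !(coefD, coefN, coefCM, coefMX, coefC, coefXn, coefX, coefMXn) qk /=.
have neq_k : (k.+3 == k.+2) = false by rewrite eqn_leq ltnn.
have ltk : (k.+3 < k.+2)%N = false by rewrite ltnNge leqnSn.
rewrite eqxx subnn subSnn ltnn ltk neq_k /=.
rewrite !(subr0, sub0r, addr0, add0r, mulr0, mulr1, mulrN1).
move=> A21 /eqP + /eqP + /eqP.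
rewrite addrC !subr_eq0 oppr_eq0 => /eqP A11 /eqP A22 /eqP A12.
set N := (A - _)%R.
have -> : N = (delta_mx i0 0 : 'cV_3) *m row i0 N.
  apply/matrixP=> i j; rewrite [RHS]mxE big_ord1 !mxE.
  have [->|->|->] := ord3P i; have [->|->|->] := ord3P j;
    by rewrite ?(A10, A20, A21, A12, A11) -?A22 /=
      ?(mulr1n, mulr0n, mul1r, mul0r, subr0, subrr).
exact: leq_trans (mxrankM_maxl _ _) (rank_leq_col _).
Qed.

Lemma dvd_scale (p r : {mpoly F[3]}) c : c != 0 -> divides p (c *: r) ->
  divides p r.
Proof.
move=> nz_c [s def_s]; exists (c^-1 *: s).
by rewrite -scalerAr -def_s scalerA mulVf // scale1r.
Qed.

Lemma linear_form_delta : linear_form (delta_mx 0 0) = 'X_i0 :> {mpoly F[3]}.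
Proof.
rewrite /linear_form (bigD1 ord0) //= mxE eqxx scale1r big1 ?addr0 // => i nz_i.
by rewrite mxE (negbTE nz_i) scale0r.
Qed.

(** Any nonzero vector is part of a basis, so a change of coordinates turns
    [linear_form v] into [X_0]. *)
Lemma normalize_linear_form A v : v != 0 -> exists A' B,
  [/\ B \in unitmx, B *m v = delta_mx 0 0, B *m A = A' *m B &
      forall e, divides (linear_form v ^+ e) (filling_form A) ->
        divides ('X_i0 ^+ e) (filling_form A')].
Proof.
move=> /unitmx_col0[B uB Bv]; exists (B *m A *m invmx B), B.
have BA : B *m A = B *m A *m invmx B *m B by rewrite mulmxKV.
split=> // e [p /(congr1 (comp_mpoly (linear_subst B)))].
rewrite (linear_subst_filling_form BA) rmorphM rmorphXn /=.
rewrite linear_subst_linear_form Bv linear_form_delta => def_p.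
have nz_det : \det B != 0 by rewrite -unitfE -unitmxE.
by apply: dvd_scale nz_det _; exists (p \mPo linear_subst B).
Qed.

Lemma dvd_filling_form_eigenvector A v : v != 0 ->
  divides (linear_form v) (filling_form A) -> exists a, A *m v = a *: v.
Proof.
move=> /normalize_linear_form-/(_ A)[A' [B [uB Bv BA dvdX]]] dvd_v.
have [|A10 A20] := @dvd_X0_filling_form A'.
  by rewrite -['X_i0]expr1; apply: dvdX.
have A'e : A' *m delta_mx 0 0 = A' i0 i0 *: (delta_mx 0 0 : 'cV_3).
  apply/colP=> i; rewrite -colE !mxE.
  by have [->|->|->] := ord3P i; rewrite ?(A10, A20) ?mulr1 ?mulr0.
exists (A' i0 i0); apply: (can_inj (mulKmx uB)).
by rewrite mulmxA BA -mulmxA Bv A'e -Bv scalemxAr.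
Qed.

Lemma dvd_sq_filling_form_rank A v : v != 0 ->
  divides (linear_form v ^+ 2) (filling_form A) ->
  exists a, (\rank (A - a%:M)%R <= 1)%N.
Proof.
move=> /normalize_linear_form-/(_ A)[A' [B [uB _ BA dvdX]]] /dvdX.
move=> /dvd_X0sq_filling_form; set a := A' i0 i0 => rk; exists a.
have uBr : row_free B by rewrite row_free_unit.
have uBl : row_full B by rewrite row_full_unit.
rewrite -(eqmxMfull _ uBl) mulmxBr BA mul_mx_scalar -mul_scalar_mx -mulmxBl.
by rewrite mxrankMfree.
Qed.

End LinearComponents.

(** * Curves that split into lines *)

Section Splitting.
Variable F : finFieldType.
Local Notation q := #|F|.
Local Notation X := (coord_row F).
Local Notation "B ^C" := (map_mx (@mpolyC 3 F) B) : ring_scope.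
Implicit Types (A B : 'M[F]_3) (v w : 'cV[F]_3).

(** In the field of fractions, where the variable [T] can be replaced by
    [x / y], this is the factorization of [T^q - T] over [F]. *)
Lemma prod_frobenius_lines n (x y : {mpoly F[n]}) :
  x ^+ q * y - y ^+ q * x = y * \prod_(a : F) (x - a *: y).
Proof.
have q_gt0 : (0 < q)%N by apply/card_gt0P; exists 0.
have [->|nz_y] := eqVneq y 0.
  by rewrite expr0n -[(q == 0)%N]negbK -lt0n q_gt0 !(mulr0, mul0r) subrr.
have [K [f inj_f]] : exists (K : fieldType) (f : {rmorphism {mpoly F[n]} -> K}),
    injective f.
  exists {fraction {mpoly F[n]}}, (@FracField.tofrac _) => u w /eqP.
  by rewrite tofrac_eq => /eqP.
pose g : {rmorphism F -> K} := f \o @mpolyC n F.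
have nz_fy : f y != 0 by rewrite -(rmorph0 f) (inj_eq inj_f).
have prod_xy : (f x / f y) ^+ q - f x / f y = \prod_(a : F) (f x / f y - g a).
  have := congr1 (fun p => (map_poly g p).[f x / f y]) (finField_genPoly F).
  rewrite rmorphB rmorph_prod /= map_polyXn map_polyX horner_prod !hornerE => ->.
  by apply: eq_bigr => a _; rewrite rmorphB /= map_polyX map_polyC !hornerE.
apply: inj_f; rewrite rmorphB !rmorphM !rmorphXn rmorph_prod /=.
have -> : \prod_a f (x - a *: y) = f y ^+ q * ((f x / f y) ^+ q - f x / f y).
  have <- : \prod_(a : F) f y = f y ^+ q by rewrite prodr_const.
  rewrite prod_xy -big_split /=; apply: eq_bigr => a _.
  by rewrite mulrBr mulrCA divff // mulr1 rmorphB -mul_mpolyC rmorphM /= mulrC.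
by rewrite expr_div_n; field; rewrite nz_fy expf_neq0.
Qed.

Lemma linear_formB v w : linear_form (v - w) = linear_form v - linear_form w.
Proof.
rewrite /linear_form -sumrB; apply: eq_bigr => i _.
by rewrite !mxE scalerBl.
Qed.

Lemma linear_formZ a v : linear_form (a *: v) = a *: linear_form v.
Proof.
by rewrite /linear_form scaler_sumr; apply: eq_bigr => i _; rewrite mxE scalerA.
Qed.

(** For [A = a + u v], only the dyad contributes to the first row of the
    determinant, whose value is [X u] times the determinant with rows [v], [X^q]
    and [X]; if [v] is the first row of [B], the latter is a binary form in the
    last two entries of [X B^-1]. *)
Lemma filling_form_split A a : \rank (A - a%:M)%R = 1%N ->
  exists c (vs : seq 'cV[F]_3), [/\ c != 0, all (fun v => v != 0) vs &
    filling_form A = c *: \prod_(v <- vs) linear_form v].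
Proof.
move=> /rank1_factor[u [v [nz_u /unitmx_row0[B uB def_v] def_N]]].
have nz_det : \det B != 0 by rewrite -unitfE -unitmxE.
pose W := X *m (invmx B)^C; pose w j : 'cV[F]_3 := invmx B *m delta_mx j 0.
have def_X : X = W *m B^C by rewrite -mulmxA -map_mxM mulVmx // map_mx1 mulmx1.
have WE j : W 0 j = linear_form (w j).
  by rewrite linear_formE map_mxM mulmxA -/W map_delta_mx -colE [RHS]mxE.
have nz_w (e : 'cV[F]_3) : e != 0 -> invmx B *m e != 0.
  by apply: contraNneq => Be0; rewrite -(mulKVmx uB e) Be0 mulmx0.
exists (\det B), [:: u, w i2 & [seq w i1 - a *: w i2 | a <- enum F]]; split=> //.
  rewrite /= nz_u nz_w /=.
    apply/allP=> _ /mapP[b _ ->]; rewrite scalemxAr -mulmxBr nz_w //.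
    by apply/eqP=> /colP/(_ i1)/eqP; rewrite !mxE mulr0 subr0 oner_eq0.
  by apply/eqP=> /colP/(_ i2)/eqP; rewrite !mxE oner_eq0.
have XA : X *m A^C = a%:MP *: X + linear_form u *: (v^C).
  rewrite -[A](subrK a%:M) def_N addrC map_mxD map_scalar_mx mulmxDr.
  rewrite mul_mx_scalar map_mxM mulmxA [X *m u^C]mx11_scalar -linear_formE.
  by rewrite mul_scalar_mx.
rewrite filling_formE XA triple_combl triple_eq_last mulr0 add0r.
have -> : triple (v^C) (frob_mx X) X =
    (\det B)%:MP * (W 0 i1 ^+ q * W 0 i2 - W 0 i2 ^+ q * W 0 i1).
  rewrite def_v map_mxM map_delta_mx def_X frob_mxM triple_mulmx det_map_mx.
  rewrite mulrC tripleE !mxE /=; congr (_ * _); ring.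
rewrite prod_frobenius_lines !WE !big_cons big_map big_enum /=.
rewrite mul_mpolyC -scalerAr; congr (_ *: (_ * (_ * _))).
by apply: eq_bigr => b _; rewrite linear_formB linear_formZ.
Qed.

Definition eigenvalue_of A v := odflt 0 [pick a | A *m v == a *: v].

Lemma eigenvalue_ofP A v : (exists a, A *m v = a *: v) ->
  A *m v = eigenvalue_of A v *: v.
Proof.
move=> [a Av]; rewrite /eigenvalue_of; case: pickP => [b /eqP //|/(_ a)].
by rewrite Av eqxx.
Qed.

(** A common eigenvalue would either come from two independent eigenvectors or
    make the two linear forms proportional, so that a square divides the filling
    form; both would give some [A - a] of rank at most one. *)
Lemma eigenvalue_of_neq A v w : char_poly A = mxminpoly A ->
  v != 0 -> w != 0 ->
  divides (linear_form v * linear_form w) (filling_form A) ->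
  eigenvalue_of A v != eigenvalue_of A w.
Proof.
move=> char_min nz_v nz_w dvd_vw.
have no_rank1 a : ~ (\rank (A - a%:M)%R <= 1)%N.
  by move=> /mxminpoly_shift_rank1; rewrite char_min eqxx.
have Av : A *m v = eigenvalue_of A v *: v.
  apply/eigenvalue_ofP/dvd_filling_form_eigenvector => //.
  by case: dvd_vw => p ->; exists (linear_form w * p); rewrite mulrA.
have Aw : A *m w = eigenvalue_of A w *: w.
  apply/eigenvalue_ofP/dvd_filling_form_eigenvector => //.
  by case: dvd_vw => p ->; exists (linear_form v * p); ring.
apply/eqP=> eq_vw; rewrite -eq_vw in Aw.
have [w_v|] := boolP [forall c, w != c *: v].
  apply: (no_rank1 (eigenvalue_of A v)); rewrite -(leq_add2r 2).
  by apply: rank_shift_eigenvectors nz_v _ Av Aw => c; apply: (forallP w_v).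
rewrite negb_forall => /existsP[c]; rewrite negbK => /eqP def_w.
have [|a] := @dvd_sq_filling_form_rank _ A v nz_v; last exact: no_rank1.
case: dvd_vw => p ->; exists (c *: p).
by rewrite def_w linear_formZ -!mul_mpolyC; ring.
Qed.

Lemma dvd_filling_form_size A (vs : seq 'cV[F]_3) :
  char_poly A = mxminpoly A -> all (fun v => v != 0) vs ->
  divides (\prod_(v <- vs) linear_form v) (filling_form A) ->
  (size vs <= 3)%N.
Proof.
move=> char_min nz_vs dvd_vs; pose ev := eigenvalue_of A.
have roots : all (root (char_poly A)) (map ev vs).
  apply/allP=> _ /mapP[v v_vs ->]; have nz_v := allP nz_vs v v_vs.
  apply: (eigenvector_root_char nz_v); apply: eigenvalue_ofP.
  apply: dvd_filling_form_eigenvector => //; case: dvd_vs => p ->.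
  by rewrite (big_rem v) //= -mulrA; eexists.
have uniq_ev : uniq (map ev vs).
  elim: vs nz_vs dvd_vs {roots} => //= v vs IHvs /andP[nz_v nz_vs] dvd_vs.
  rewrite IHvs ?andbT //; last first.
    by case: dvd_vs => p ->; exists (linear_form v * p); rewrite big_cons; ring.
  apply/mapP=> -[w w_vs]; apply/eqP/eigenvalue_of_neq => //.
    exact: (allP nz_vs).
  case: dvd_vs => p ->; rewrite big_cons (big_rem w) //=.
  by exists (\prod_(y <- rem w vs) linear_form y * p); ring.
have nz_char : char_poly A != 0 by rewrite monic_neq0 ?char_poly_monic.
have := max_poly_roots nz_char roots uniq_ev.
by rewrite size_char_poly size_map.
Qed.

End Splitting.

Theorem corollary4p2 (F : finFieldType) (A : 'M[F]_3) :
  ~~ is_scalar_mx A ->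
  reducible (filling_form A) ->
  (exists (d : nat) (G : {mpoly F[3]}),
      (1 < d)%N /\ component_of_degree d G (filling_form A)) <->
  char_poly A = mxminpoly A.
Proof.
move=> nscA _; split=> [[d [G [d_gt1 [homG irrG dvdG]]]]|char_min].
  apply/eqP; apply: contraTT d_gt1 => /(mxminpoly_neq_char_rank1 nscA)[a rk1].
  have [c [vs [nz_c nz_vs def_F]]] := filling_form_split rk1.
  rewrite def_F in dvdG; rewrite -leqNgt.
  exact: irreducible_dvd_linear_forms homG irrG nz_c nz_vs dvdG.
have not_dvd_sq (v : 'cV[F]_3) : v != 0 ->
    ~ divides (linear_form v ^+ 2) (filling_form A).
  move=> nz_v /(dvd_sq_filling_form_rank nz_v)[a /mxminpoly_shift_rank1].
  by rewrite char_min eqxx.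
have nzF : filling_form A != 0.
  apply/eqP=> F0; apply: (not_dvd_sq (delta_mx 0 0)).
    by apply/eqP=> /colP/(_ 0)/eqP; rewrite !mxE oner_eq0.
  by rewrite F0; exists 0; rewrite mulr0.
apply: NNPP => no_comp.
have [|c [vs [sz_vs nz_vs def_F]]] :=
    linear_factorization nzF (filling_form_homog A).
  move=> e G homG irrG dvdG; rewrite leqNgt; apply/negP=> e_gt1.
  by apply: no_comp; exists e, G.
have [k qk] := card_finField_SS F.
have : (size vs <= 3)%N; last by rewrite sz_vs qk addn2.
apply: (dvd_filling_form_size char_min nz_vs).
by rewrite def_F -mul_mpolyC mulrC; eexists.
Qed.
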